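(* A timelike loxodrome on a timelike right helicoidal surface of type II in $\mathbb{E}^n_1$, the surface being parametrized by $H_2^R(u,v)=(x_{1_0}+cv,x_2(u),\dots,x_{n-2}(u),x_n(u)\sinh v,x_n(u)\cosh v)$ with $x_{1_0}$ a constant, is parametrized by $\alpha_2^R(u)=H_2^R(u,v(u))$, where $v(u)$ is given by $$v(u)=\pm\tanh\phi_0\int_{u_0}^u\frac{d\xi}{\sqrt{x_n^2(\xi)+c^2}}$$ and $c,\phi_0>0$ are constants, $\phi_0$ being the constant angle of the loxodrome with the meridians.
   Context: $\mathbb{E}^n_1$ is $\mathbb{R}^n$ with the metric $\langle\cdot,\cdot\rangle$ given by $dx_1^2+\cdots+dx_{n-1}^2-dx_n^2$, and $\|w\|=\sqrt{|\langle w,w\rangle|}$. A vector $w$ is spacelike if $\langle w,w\rangle>0$ or $w=0$, timelike if $\langle w,w\rangle<0$; a curve is spacelike or timelike if its velocity is. Right helicoidal surface of type II: the profile curve $u\mapsto(x_{1_0},x_2(u),\dots,x_{n-2}(u),0,x_n(u))$ is a smooth regular curve defined on an open interval $I\subset\mathbb{R}$, with constant first coordinate (this is what ''right'' means) and parametrized by arc length, i.e. $x_2'^2+\cdots+x_{n-2}'^2-x_n'^2=\varepsilon$ with $\varepsilon=\pm1$. The surface is parametrized by $H_2^R(u,v)$ as in the claim, with $u\in I$, $v\in\mathbb{R}$. It is timelike if $EG-F^2<0$, where $E,F,G$ are the coefficients of the induced metric $E\,du^2+2F\,du\,dv+G\,dv^2$; that is, $\varepsilon(c^2+x_n^2(u))<0$,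 so that $\varepsilon=-1$. The meridians are the curves $u\mapsto H_2^R(u,v_0)$ with $v_0$ constant; since $\varepsilon=-1$, they are timelike. Lorentzian timelike angle: for timelike vectors $x,y$, it is the unique nonnegative real number $\theta$ with $\langle x,y\rangle=\|x\|\|y\|\cosh\theta$. A timelike loxodrome on the surface is a timelike curve $\alpha(t)=H_2^R(u(t),v(t))$ that intersects the meridians at a constant angle $\phi_0$, i.e. the Lorentzian timelike angle between its velocity and the meridian tangent vector $(H_2^R)_u$ is $\phi_0$ at each point. The number $u_0$ is a fixed value of the parameter $u$.
   Formalization: A loxodrome stays one when a constant is added to v, so the formula for v(u) is proved up to an additive constant, which is 0 when the curve passes through u=u_0, v=0; the angle as defined forces u to decrease along the curve, the other direction following by reversing t. *)

(* Defs.v *)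
From Stdlib Require Import Reals.
From mathcomp Require Import ssreflect ssrfun ssrbool eqtype ssrnat seq fintype bigop.
From Coquelicot Require Import Coquelicot.

Set Implicit Arguments.
Unset Strict Implicit.
Unset Printing Implicit Defensive.

Open Scope R_scope.

Definition vec (n : nat) := 'I_n -> R.

(* The coordinates x_1, ..., x_n are indexed by i = 0, ..., n-1, so the
   timelike coordinate x_n is the one with i.+1 = n. *)
Definition lorentz (n : nat) (x y : vec n) : R :=
  \big[Rplus/0]_(i < n) ((if i.+1 == n then -1 else 1) * x i * y i).

Definition lnorm (n : nat) (x : vec n) : R := sqrt (Rabs (lorentz x x)).

Definition timelike (n : nat) (x : vec n) : Prop := lorentz x x < 0.

(* No minus sign in front of the norms: such a theta exists only when the two
   timelike vectors have opposite time orientations. *)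
Definition is_timelike_angle (n : nat) (x y : vec n) (theta : R) : Prop :=
  timelike x /\ timelike y /\ 0 <= theta /\
  lorentz x y = lnorm x * lnorm y * cosh theta.

Definition in_oi (a b : Rbar) (t : R) : Prop := Rbar_lt a t /\ Rbar_lt t b.

Definition smooth_on (a b : Rbar) (f : R -> R) : Prop :=
  forall (k : nat) (t : R), in_oi a b t -> ex_derive_n f k t.

Definition velocity (n : nat) (g : R -> vec n) (t : R) : vec n :=
  fun i => Derive (fun s => g s i) t.

Definition smooth_regular_curve (n : nat) (a b : Rbar) (g : R -> vec n) : Prop :=
  (forall i : 'I_n, smooth_on a b (fun t => g t i)) /\
  (forall t, in_oi a b t -> exists i : 'I_n, velocity g t i <> 0).

(* In the next two definitions x k is the k-th coordinate function, numbered
   from 1; only x 2, ..., x (n-2) and x n are used. *)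
Definition profile (n : nat) (x10 : R) (x : nat -> R -> R) (u : R) : vec n :=
  fun i => if i.+1 == 1%N then x10
           else if i.+1 == n.-1 then 0
           else x i.+1 u.

Definition helicoid (n : nat) (c x10 : R) (x : nat -> R -> R) (u v : R) : vec n :=
  fun i => if i.+1 == 1%N then x10 + c * v
           else if i.+1 == n.-1 then x n u * sinh v
           else if i.+1 == n then x n u * cosh v
           else x i.+1 u.

Definition partial_u (n : nat) (S : R -> R -> vec n) (u v : R) : vec n :=
  velocity (fun w => S w v) u.

Definition partial_v (n : nat) (S : R -> R -> vec n) (u v : R) : vec n :=
  velocity (fun w => S u w) v.

Definition coefE (n : nat) (S : R -> R -> vec n) (u v : R) : R :=
  lorentz (partial_u S u v) (partial_u S u v).

Definition coefF (n : nat) (S : R -> R -> vec n) (u v : R) : R :=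
  lorentz (partial_u S u v) (partial_v S u v).

Definition coefG (n : nat) (S : R -> R -> vec n) (u v : R) : R :=
  lorentz (partial_v S u v) (partial_v S u v).

Definition timelike_surface (n : nat) (a b : Rbar) (S : R -> R -> vec n) : Prop :=
  forall u v, in_oi a b u ->
    coefE S u v * coefG S u v - coefF S u v ^ 2 < 0.

Definition timelike_loxodrome (n : nat) (a b : Rbar) (S : R -> R -> vec n)
    (p q : Rbar) (u v : R -> R) (phi0 : R) : Prop :=
  smooth_on p q u /\ smooth_on p q v /\
  (forall t, in_oi p q t -> in_oi a b (u t)) /\
  (forall t, in_oi p q t ->
     timelike (velocity (fun r => S (u r) (v r)) t) /\
     is_timelike_angle (velocity (fun r => S (u r) (v r)) t)
       (partial_u S (u t) (v t)) phi0).

(* s = 1 or s = -1 is the sign in the formula. *)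
Definition loxodrome_v (s phi0 c : R) (xn : R -> R) (u0 u : R) : R :=
  s * tanh phi0 * RInt (fun xi => 1 / sqrt (xn xi ^ 2 + c ^ 2)) u0 u.

(* Main.v *)
(* On the helicoid E = eps, F = 0 and G = x_n^2 + c^2, so eps = -1 and the angle
   condition becomes - u' = sqrt (u'^2 - G v'^2) cosh phi0.  Hence u' < 0 and
   G v'^2 = (tanh phi0 u')^2; in particular v' never vanishes, so it has a
   constant sign on the interval and v' = s tanh phi0 u' / sqrt G with s fixed,
   which integrates to the formula. *)

Require Import Defs.
From Stdlib Require Import Reals.
From mathcomp Require Import ssreflect ssrfun ssrbool eqtype ssrnat seq fintype bigop.
From Coquelicot Require Import Coquelicot.
From HB Require Import structures.
From Stdlib Require Import Lra Classical Ranalysis5.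

Set Implicit Arguments.

(** Makes the [bigop] lemmas that need a monoid law apply to the sum in [lorentz]. *)
HB.instance Definition _ := Monoid.isComLaw.Build R 0 Rplus
  (fun x y z => esym (Rplus_assoc x y z)) Rplus_comm Rplus_0_l.

(** * The Lorentz form and hyperbolic functions *)

Lemma lorentzC n (x y : vec n) : lorentz x y = lorentz y x.
Proof. by apply: eq_bigr => i _; ring. Qed.

(** The combination is given coordinatewise, the form in which the chain rule supplies it, so no
    extensionality of vectors is involved. *)
Lemma lorentz_lin n (x y w z : vec n) k l :
  (forall i, w i = k * x i + l * y i) ->
  lorentz w z = k * lorentz x z + l * lorentz y z.
Proof.
move=> Ew; apply: (big_rec3 (fun a b c => a = k * b + l * c)); first by ring.
by move=> i ? ? ? _ ->; rewrite Ew; ring.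
Qed.

(** Isolates the plane of the last two coordinates, where the helicoid moves by hyperbolic rotation,
    from the Euclidean block. With [m.+3] coordinates that block still contains the first
    coordinate. *)
Lemma lorentz_split m (x y : vec m.+3) :
  let w i := widen_ord (leqnSn m.+2) (widen_ord (leqnSn m.+1) i) in
  let j := widen_ord (leqnSn m.+2) ord_max in
  lorentz x y = \big[Rplus/0]_(i < m.+1) (x (w i) * y (w i))
                + x j * y j - x ord_max * y ord_max.
Proof.
move=> w j; rewrite /lorentz 2!big_ord_recr /= eqxx !eqSS (ltn_eqF (leqnn _)).
rewrite /Rminus; congr (_ + _ + _); last by ring.
  apply: eq_bigr => i _; rewrite /= !eqSS.
  by rewrite (ltn_eqF (ltn_trans (ltn_ord i) (ltnSn _))) Rmult_1_l.
by rewrite Rmult_1_l.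
Qed.

Lemma is_derive_sinh v : is_derive sinh v (cosh v).
Proof. exact/is_derive_Reals/derivable_pt_lim_sinh. Qed.

Lemma is_derive_cosh v : is_derive cosh v (sinh v).
Proof. exact/is_derive_Reals/derivable_pt_lim_cosh. Qed.

Lemma cosh2_sinh2 v : cosh v * cosh v = 1 + sinh v * sinh v.
Proof.
rewrite /cosh /sinh; have := exp_plus v (- v); rewrite Rplus_opp_r exp_0.
by move=> ?; nra.
Qed.

Lemma cosh_gt0 y : 0 < cosh y.
Proof. by rewrite /cosh; have := exp_pos y; have := exp_pos (- y); lra. Qed.

Lemma tanh_gt0 y : 0 < y -> 0 < tanh y.
Proof.
move=> y0; apply: Rdiv_lt_0_compat (cosh_gt0 y).
by rewrite -sinh_0; exact: sinh_lt.
Qed.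

(** * Tangent vectors and induced metric of the helicoid *)

Section Helicoid.

Context {m : nat}.
Variables (c x10 : R) (x : nat -> R -> R).
Notation n := m.+3.
Notation H := (@helicoid n c x10 x).

Lemma velocity_profile u i :
  velocity (@profile n x10 x) u i =
  if i.+1 == 1%N then 0 else if i.+1 == n.-1 then 0 else Derive (x i.+1) u.
Proof.
rewrite /velocity /profile; case: ifP => _; first exact: Derive_const.
by case: ifP => _; first exact: Derive_const.
Qed.

Lemma partial_u_helicoid u v i :
  partial_u H u v i =
  if i.+1 == 1%N then 0
  else if i.+1 == n.-1 then Derive (x n) u * sinh v
  else if i.+1 == n then Derive (x n) u * cosh v else Derive (x i.+1) u.
Proof.
rewrite /partial_u /velocity /helicoid; case: ifP => _; first exact: Derive_const.
by case: ifP => _; [|case: ifP => _ //]; rewrite Derive_scal_l.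
Qed.

Lemma partial_v_helicoid u v i :
  partial_v H u v i =
  if i.+1 == 1%N then c
  else if i.+1 == n.-1 then x n u * cosh v
  else if i.+1 == n then x n u * sinh v else 0.
Proof.
rewrite /partial_v /velocity /helicoid; case: ifP => _.
  by apply: is_derive_unique; auto_derive=> //; ring.
case: ifP => _; first by rewrite Derive_scal (is_derive_unique _ _ _ (is_derive_sinh _)).
case: ifP => _; first by rewrite Derive_scal (is_derive_unique _ _ _ (is_derive_cosh _)).
exact: Derive_const.
Qed.

(** A hyperbolic rotation of the last two coordinates preserves the form, and the translation along
    the first axis does not depend on [u]. *)
Lemma coefE_helicoid u v :
  coefE H u v = lorentz (velocity (@profile n x10 x) u) (velocity (@profile n x10 x) u).
Proof.
rewrite /coefE !lorentz_split !partial_u_helicoid !velocity_profile /=.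
rewrite !eqSS !eqxx (gtn_eqF (ltnSn _)) /Rminus Rplus_assoc [RHS]Rplus_assoc.
congr (_ + _); last by have := cosh2_sinh2 v; nra.
apply: eq_bigr => i _; rewrite partial_u_helicoid velocity_profile /= !eqSS.
by rewrite (ltn_eqF (ltn_ord i)) (ltn_eqF (ltn_trans (ltn_ord i) (ltnSn _))).
Qed.

(** In the last two coordinates [(sinh v, cosh v)] and [(cosh v, sinh v)] are Lorentz orthogonal; in
    each other coordinate one of the two tangent vectors vanishes. *)
Lemma coefF_helicoid u v : coefF H u v = 0.
Proof.
rewrite /coefF !lorentz_split !partial_u_helicoid !partial_v_helicoid /=.
rewrite !eqSS !eqxx (gtn_eqF (ltnSn _)) big1 => [|i _]; first by ring.
rewrite partial_u_helicoid partial_v_helicoid /= !eqSS.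
rewrite (ltn_eqF (ltn_ord i)) (ltn_eqF (ltn_trans (ltn_ord i) (ltnSn _))).
by case: ifP => _; ring.
Qed.

(** The translation contributes [c ^ 2] through the first coordinate, split off by [big_ord_recl];
    the rotation contributes [x n u ^ 2] since [cosh ^ 2 - sinh ^ 2 = 1]. *)
Lemma coefG_helicoid u v : coefG H u v = x n u ^ 2 + c ^ 2.
Proof.
rewrite /coefG !lorentz_split !partial_v_helicoid /=.
rewrite !eqSS !eqxx (gtn_eqF (ltnSn _)) big_ord_recl big1 => [|i _].
  by rewrite partial_v_helicoid /=; have := cosh2_sinh2 v; nra.
rewrite partial_v_helicoid /= !eqSS (ltn_eqF (ltn_ord i)).
by rewrite (ltn_eqF (ltn_trans (ltn_ord i) (ltnSn _))); ring.
Qed.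

(** The chain rule. Differentiability is asked exactly of the coordinate functions that occur in
    [helicoid], since [x 1] and [x n.-1] are arbitrary. *)
Lemma velocity_helicoid u v t i :
  (forall k : 'I_n, k.+1 != 1%N -> k.+1 != n.-1 -> ex_derive (x k.+1) (u t)) ->
  ex_derive u t -> ex_derive v t ->
  velocity (fun r => H (u r) (v r)) t i =
  Derive u t * partial_u H (u t) (v t) i + Derive v t * partial_v H (u t) (v t) i.
Proof.
move=> hx du dv.
have dxn : ex_derive (x n) (u t).
  by apply: (hx ord_max) => //=; rewrite !eqSS (gtn_eqF (ltnSn _)).
have esinh : ex_derive sinh (v t) by exists (cosh (v t)); exact: is_derive_sinh.
have ecosh : ex_derive cosh (v t) by exists (sinh (v t)); exact: is_derive_cosh.
rewrite partial_u_helicoid partial_v_helicoid /velocity /helicoid.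
have dxu : ex_derive (fun s => x n (u s)) t by exact: (ex_derive_comp (x n) u).
have dsinh : ex_derive (fun s => sinh (v s)) t by exact: (ex_derive_comp sinh v).
have dcosh : ex_derive (fun s => cosh (v s)) t by exact: (ex_derive_comp cosh v).
case: ifP => h1.
  rewrite Derive_plus ?Derive_const ?Derive_scal; first by ring.
    exact: ex_derive_const.
  exact: ex_derive_scal.
case: ifP => h2.
  rewrite Derive_mult // (Derive_comp (x n) u) // (Derive_comp sinh v) //.
  rewrite (is_derive_unique _ _ _ (is_derive_sinh _)).
  by ring.
case: ifP => h3.
  rewrite Derive_mult // (Derive_comp (x n) u) // (Derive_comp cosh v) //.
  rewrite (is_derive_unique _ _ _ (is_derive_cosh _)).
  by ring.
rewrite (Derive_comp (x i.+1) u) //; first by ring.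
exact: hx (negbT h1) (negbT h2).
Qed.

End Helicoid.

(** * Calculus on open intervals, and the algebra of the angle condition *)

Lemma in_oi_le p q t1 t2 t :
  in_oi p q t1 -> in_oi p q t2 -> t1 <= t <= t2 -> in_oi p q t.
Proof.
move=> [h1 _] [_ h2] [le1 le2]; split.
  exact: (Rbar_lt_le_trans p t1 t).
exact: (Rbar_le_lt_trans t t2 q).
Qed.

Lemma in_oi_min_max p q t1 t2 t :
  in_oi p q t1 -> in_oi p q t2 -> Rmin t1 t2 <= t <= Rmax t1 t2 -> in_oi p q t.
Proof.
by move=> h1 h2; apply: in_oi_le; [apply: Rmin_case | apply: Rmax_case].
Qed.

Lemma locally_in_oi p q t : in_oi p q t -> locally t (in_oi p q).
Proof.
by move=> ht; apply: (open_and _ _ (open_Rbar_gt p) (open_Rbar_lt q)).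
Qed.

(** The fundamental theorem of calculus wants the integral from [u0] to exist for all upper bounds
    near [u]; openness of the interval provides this, on either side of [u0]. *)
Lemma is_derive_RInt_oi a b (f : R -> R) u0 u :
  (forall t, in_oi a b t -> continuous f t) ->
  in_oi a b u0 -> in_oi a b u -> is_derive (RInt f u0) u (f u).
Proof.
move=> cf hu0 hu; apply: (is_derive_RInt f _ u0); last exact: cf.
apply: (filter_imp (in_oi a b)); last exact: locally_in_oi.
move=> t ht; apply/RInt_correct/ex_RInt_continuous => z hz.
exact/cf/(in_oi_min_max hu0 ht hz).
Qed.

Lemma derive0_const p q (f : R -> R) t1 t2 :
  (forall t, in_oi p q t -> is_derive f t 0) ->
  in_oi p q t1 -> in_oi p q t2 -> f t1 = f t2.
Proof.
move=> df h1 h2; have [lt|[->//|lt]] := Rtotal_order t1 t2; last symmetry.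
all: apply: eq_is_derive => // t ht; apply: df; apply: in_oi_le ht => //.
Qed.

Lemma same_sign p q (f : R -> R) t1 t2 :
  (forall t, in_oi p q t -> continuous f t) ->
  (forall t, in_oi p q t -> f t <> 0) ->
  in_oi p q t1 -> in_oi p q t2 -> 0 < f t1 -> 0 < f t2.
Proof.
move=> cf nz h1 h2 pos1; apply: Rnot_le_lt => neg2.
have {}neg2 : f t2 < 0 by have := nz _ h2; lra.
have [lt|[E|lt]] := Rtotal_order t1 t2; last 1 first.
- have [z [hz /nz[]//]] := IVT_interv f t2 t1 (fun t ht =>
    proj2 (continuity_pt_filterlim _ _) (cf t (in_oi_le h2 h1 ht))) lt neg2 pos1.
  exact: in_oi_le h2 h1 hz.
(* [IVT_interv] expects a negative value at the left end and a positive one at the right, so this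
   order of the points goes through [- f]. *)
- have cg t : t1 <= t <= t2 -> continuity_pt (fun t => - f t) t.
    move=> ht; apply/continuity_pt_opp/continuity_pt_filterlim.
    exact/cf/(in_oi_le h1 h2 ht).
  have [||z [hz Ez]] := IVT_interv _ t1 t2 cg lt; try lra.
  by case: (nz z (in_oi_le h1 h2 hz)); lra.
by rewrite E in pos1; lra.
Qed.

Lemma constant_sign p q (f : R -> R) :
  (forall t, in_oi p q t -> continuous f t) ->
  (forall t, in_oi p q t -> f t <> 0) ->
  exists s, (s = 1 \/ s = -1) /\ forall t, in_oi p q t -> 0 < s * f t.
Proof.
move=> cf nz; have [[t1 [h1 pos1]]|none] :=
  classic (exists t, in_oi p q t /\ 0 < f t).
  exists 1; split; first by left.
  by move=> t ht; rewrite Rmult_1_l; exact: (same_sign cf nz h1 ht pos1).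
exists (-1); split; first by right.
move=> t ht; have := nz t ht; have : ~ 0 < f t by move=> pos; apply: none; exists t.
by lra.
Qed.

(** Put [w = U ^ 2 - G * V ^ 2 > 0]. Squaring the angle equation gives [U ^ 2 = w * cosh ^ 2], hence
    [G * V ^ 2 = w * sinh ^ 2]. The sign of [U] is read off before squaring. *)
Lemma angle_solve U V G phi0 :
  - U ^ 2 + G * V ^ 2 < 0 ->
  - U = sqrt (Rabs (- U ^ 2 + G * V ^ 2)) * cosh phi0 ->
  U < 0 /\ G * V ^ 2 = (tanh phi0 * U) ^ 2.
Proof.
move=> neg E.
have C0 := cosh_gt0 phi0.
rewrite Rabs_left // in E.
set w := - (_ + _) in E; have w0 : 0 < w by rewrite /w; lra.
have S0 := sqrt_lt_R0 _ w0; have S2 := sqrt_sqrt _ (Rlt_le _ _ w0).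
split; first by have := Rmult_lt_0_compat _ _ S0 C0; lra.
have U2 : U ^ 2 = w * (cosh phi0 * cosh phi0).
  by rewrite -S2; transitivity ((- U) ^ 2); [ring | rewrite E; ring].
have tc : tanh phi0 * cosh phi0 = sinh phi0.
  by rewrite /tanh; field; lra.
have -> : (tanh phi0 * U) ^ 2 = w * (sinh phi0 * sinh phi0).
  by rewrite -tc Rpow_mult_distr U2; ring.
have -> : G * V ^ 2 = U ^ 2 - w by rewrite /w; ring.
by rewrite U2 cosh2_sinh2; ring.
Qed.

(** * Integration of the angle condition along the loxodrome *)

Unset Implicit Arguments.

Theorem corollary4p3
  (n : nat) (hn : (3 <= n)%N)
  (a b : Rbar) (c x10 eps : R) (x : nat -> R -> R)
  (hc : 0 < c)
  (hsmooth : smooth_regular_curve a b (@profile n x10 x))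
  (heps : eps = 1 \/ eps = -1)
  (harc : forall u, in_oi a b u ->
     lorentz (velocity (@profile n x10 x) u) (velocity (@profile n x10 x) u) = eps)
  (htime : timelike_surface a b (@helicoid n c x10 x))
  (p q : Rbar) (u v : R -> R) (phi0 : R) (hphi0 : 0 < phi0)
  (hlox : timelike_loxodrome a b (@helicoid n c x10 x) p q u v phi0)
  (u0 : R) (hu0 : in_oi a b u0) :
  (* u is a regular change of parameter *)
  (forall t, in_oi p q t -> Derive u t <> 0) /\
  exists s v0 : R,
    (s = 1 \/ s = -1) /\
    (* the constant of integration: v0 = 0 if the curve passes through (u0, 0) *)
    ((exists t0, in_oi p q t0 /\ u t0 = u0 /\ v t0 = 0) -> v0 = 0) /\
    (forall t, in_oi p q t ->
       v t = v0 + loxodrome_v s phi0 c (x n) u0 (u t) /\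
       @helicoid n c x10 x (u t) (v t)
         = @helicoid n c x10 x (u t) (v0 + loxodrome_v s phi0 c (x n) u0 (u t))).
Proof.
case: n hn hsmooth harc htime hlox => [|[|[|m]]] // _ hsmooth harc htime
  [su [sv [uoi hang]]].
set n := m.+3 in hsmooth harc htime hang *.
pose G w := x n w ^ 2 + c ^ 2.
have G0 w : 0 < G w by rewrite /G; nra.
have R0 w : 0 < sqrt (G w) by exact/sqrt_lt_R0.
have T0 := tanh_gt0 hphi0.
(* At [u0] the timelike condition reads [eps * G u0 < 0] with [G u0 > 0]. *)
have eps1 : eps = -1.
  have := htime u0 0 hu0; rewrite coefE_helicoid coefF_helicoid coefG_helicoid.
  by rewrite (harc _ hu0) -/n -/(G u0); have := G0 u0; case: heps => ->; lra.
have hx (k : 'I_n) : k.+1 != 1%N -> k.+1 != n.-1 -> smooth_on a b (x k.+1).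
  move=> /negbTE k1 /negbTE k2 j w hw.
  by have := proj1 hsmooth k j w hw; rewrite /profile k1 k2.
have dxn w : in_oi a b w -> ex_derive (x n) w.
  by apply: (hx ord_max _ _ 1%N) => //=; rewrite !eqSS (gtn_eqF (ltnSn _)).
have du t : in_oi p q t -> ex_derive u t by exact: (su 1%N).
have dv t : in_oi p q t -> ex_derive v t by exact: (sv 1%N).
have key t : in_oi p q t ->
    Derive u t < 0 /\ G (u t) * Derive v t ^ 2 = (tanh phi0 * Derive u t) ^ 2.
  move=> ht; have [tl [_ [tlu [_ ang]]]] := hang t ht.
  have Ev i := velocity_helicoid c x10 x i
    (fun k k1 k2 => hx k k1 k2 1%N _ (uoi t ht)) (du t ht) (dv t ht).
  have E : coefE (@helicoid n c x10 x) (u t) (v t) = -1.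
    by rewrite coefE_helicoid harc //; exact: uoi.
  have F : coefF (@helicoid n c x10 x) (u t) (v t) = 0 by exact: coefF_helicoid.
  have G' : coefG (@helicoid n c x10 x) (u t) (v t) = G (u t).
    exact: coefG_helicoid.
  rewrite /coefE /coefF /coefG in E F G'.
  (* Only the Gram matrix of the tangent vectors [A], [B] matters from here on: it is diagonal with
     entries [-1] and [G (u t)], and the velocity is [W = u' A + v' B]. *)
  move: (velocity _ t) (partial_u _ _ _) (partial_v _ _ _) Ev E F G' tl ang
    => W A B Ev E F G' tl ang.
  have Lw z := lorentz_lin _ _ _ z Ev.
  have Lu : lorentz W A = - Derive u t by rewrite Lw E (lorentzC B) F; ring.
  have Lv : lorentz W B = Derive v t * G (u t) by rewrite Lw F G'; ring.
  have La : lorentz W W = - Derive u t ^ 2 + G (u t) * Derive v t ^ 2.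
    by rewrite Lw !(lorentzC _ W) Lu Lv; ring.
  apply: angle_solve => //; first by rewrite -La.
  rewrite /lnorm La E Lu Rabs_Ropp Rabs_R1 sqrt_1 in ang.
  by rewrite Rmult_1_r in ang.
split; first by move=> t /key [? _]; lra.
have [s [hs sV]] : exists s, (s = 1 \/ s = -1) /\
    forall t, in_oi p q t -> 0 < s * Derive v t.
  apply: constant_sign => t ht.
    (* The second derivative of [v] exists, so [Derive v] is continuous. *)
    by apply: ex_derive_continuous; exact: (sv 2%N).
  move=> V0; have [U0] := key t ht; rewrite V0 => E.
  by have := Rmult_lt_0_compat _ (- Derive u t) T0; nra.
(* Here [s] is the sign of [v']. Since [u' < 0], the sign in the formula is the opposite one. *)
pose L := loxodrome_v (- s) phi0 c (x n) u0.
have dL w : in_oi a b w -> is_derive L w (- s * tanh phi0 / sqrt (G w)).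
  move=> hw; rewrite /L /loxodrome_v /Rdiv.
  apply: is_derive_scal; rewrite -[/ _]Rmult_1_l.
  apply: (@is_derive_RInt_oi a b (fun y => 1 / sqrt (G y))) => // y hy.
  apply: ex_derive_continuous; rewrite /G; auto_derive.
  have := G0 y; have := R0 y; rewrite /G /= => Ry Gy.
  by split; [exact: dxn | split; [|split; [lra|]]].
have dV t : in_oi p q t -> Derive v t = Derive u t * (- s * tanh phi0 / sqrt (G (u t))).
  move=> ht; have [U0 eqV] := key t ht; have V0 := sV t ht.
  have R0t := R0 (u t).
  rewrite -{1}(sqrt_sqrt (G (u t))) in eqV; last exact/Rlt_le/G0.
  apply: (Rmult_eq_reg_l (sqrt (G (u t)))); last by lra.
  transitivity (- s * tanh phi0 * Derive u t); last by field; lra.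
  have ss : s * s = 1 by case: hs => ->; ring.
  (* Both sides are positive, so the equality of their squares in [eqV] suffices. *)
  have RV : sqrt (G (u t)) * (s * Derive v t) = tanh phi0 * - Derive u t.
    have RV0 := Rmult_lt_0_compat _ _ R0t V0.
    have TU0 := Rmult_lt_0_compat _ (- Derive u t) T0 ltac:(lra).
    apply: Rsqr_inj; try lra; rewrite /Rsqr.
    transitivity ((tanh phi0 * Derive u t) ^ 2); last by ring.
    by rewrite -eqV -[RHS]Rmult_1_r -ss; ring.
  by rewrite -[LHS]Rmult_1_r -ss; have := f_equal (Rmult s) RV; lra.
(* By [dV] and the chain rule, [v - L (u)] has zero derivative. *)
have const t1 t2 : in_oi p q t1 -> in_oi p q t2 ->
    v t1 - L (u t1) = v t2 - L (u t2).
  apply: (@derive0_const p q (fun t => v t - L (u t))) => t ht.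
  have := is_derive_minus _ _ _ _ _ (Derive_correct _ _ (dv t ht))
    (is_derive_comp _ _ _ _ _ (dL _ (uoi t ht)) (Derive_correct _ _ (du t ht))).
  rewrite (dV t ht) /minus plus_opp_r; exact.
(* The constant of integration is read off at some [t1]; if the parameter interval is empty, the
   claims about its points are vacuous and [0] serves. *)
have [[t1 ht1]|none] := classic (exists t, in_oi p q t); last first.
  exists (- s), 0; split; first by case: hs => ->; lra.
  by split=> // t ht; case: none; exists t.
exists (- s), (v t1 - L (u t1)); split; first by case: hs => ->; lra.
split=> [[t0 [ht0 [ut0 vt0]]]|t ht].
  (* The constant can be evaluated at [t0] instead, where the integral runs from [u0] to [u0]. *)
  by rewrite (const _ _ ht1 ht0) ut0 vt0 /L /loxodrome_v RInt_point /zero /=; ring.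
suff -> : v t = v t1 - L (u t1) + loxodrome_v (- s) phi0 c (x n) u0 (u t) by [].
by rewrite -/(L (u t)) (const _ _ ht1 ht); ring.
Qed.
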